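(* Let $k$ be an algebraically closed field of characteristic $0$, let $m<n$ be relatively prime positive integers, and let $a$ be a positive integer. Let $C\subset\mathbb{P}(1,m,n)$ be the Fermat-type curve of degree $amn$, defined by $x_0^{amn}+x_1^{an}-x_2^{am}=0$. Then the genus of $C$ is $$g(C)=\frac{(am-1)(an-2)+a(m-1)}{2}.$$
   Context: $\mathbb{P}(1,m,n)=\mathrm{Proj}\,k[x_0,x_1,x_2]$ is the weighted projective plane over $k$, where the polynomial ring is graded by $\deg x_0=1$, $\deg x_1=m$, $\deg x_2=n$. A Fermat-type curve of degree $amn$ is the closed subscheme $C\subset\mathbb{P}(1,m,n)$ defined by the (weighted) homogeneous polynomial $x_0^{amn}+x_1^{an}-x_2^{am}$. *)

(* Defs.v *)
From HB Require Import structures.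
From mathcomp Require Import all_boot all_order all_algebra.
From mathcomp.multinomials Require Export mpoly.

Set Implicit Arguments.
Unset Strict Implicit.
Unset Printing Implicit Defensive.

Import GRing.Theory.
Local Open Scope ring_scope.

Notation "x %:F" := (@FracField.tofrac _ x) : ring_scope.

(* Hypersurfaces in the weighted projective space P(w) = Proj S, where
   S = k[x_0, ..., x_(N-1)] and deg x_i = w i.  For I a set of indices, x_I is
   the product of the x_i with i in I and D_+(x_I) is the affine open subset of
   P(w) where no x_i with i in I vanishes.  Since S is a domain, its
   localisation S_(x_I) is taken inside the fraction field of S. *)

Definition wdeg N (w : 'I_N -> nat) (e : 'X_{1..N}) : nat :=
  (\sum_(i < N) w i * e i)%N.

Fact wdeg0 N (w : 'I_N -> nat) : wdeg w 0%MM = 0%N.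
Proof. by rewrite /wdeg big1 // => i _; rewrite mnm0E muln0. Qed.

Fact wdegD N (w : 'I_N -> nat) :
  {morph wdeg w : e1 e2 / (e1 + e2)%MM >-> (e1 + e2)%N}.
Proof.
by move=> e1 e2; rewrite /wdeg -big_split; apply: eq_bigr => i _ /=;
  rewrite mnmDE mulnDr.
Qed.

HB.instance Definition _ N (w : 'I_N -> nat) :=
  isMeasure.Build N (wdeg w) (wdeg0 w) (wdegD w).

Definition supported_in N (I : {set 'I_N}) (e : 'X_{1..N}) : Prop :=
  forall i, e i != 0%N -> i \in I.

Section Hypersurface.
Variables (k : fieldType) (N : nat) (w : 'I_N -> nat).
Local Notation S := {mpoly k[N]}.
Local Notation K := {fraction S}.

(* The degree 0 part of S_(x_I), i.e. the ring of sections of the structure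
   sheaf of P(w) over D_+(x_I). *)
Definition proj_section (I : {set 'I_N}) (u : K) : Prop :=
  exists (e : 'X_{1..N}) (p : S),
    [/\ supported_in I e,
        p \is (wdeg w e).-homog for (wdeg w)
      & u = p%:F / ('X_[e] : S)%:F].

Variable f : S.

(* For f homogeneous: the degree 0 part of f S_(x_I), i.e. the sections over
   D_+(x_I) of the ideal sheaf of the closed subscheme C = Proj (S / f).  As
   localisation and taking degree 0 parts are exact, the ring of sections of O_C
   over D_+(x_I) is the quotient of [proj_section I] by [ideal_section I]. *)
Definition ideal_section (I : {set 'I_N}) (u : K) : Prop :=
  exists (e : 'X_{1..N}) (p : S),
    [/\ supported_in I e,
        f * p \is (wdeg w e).-homog for (wdeg w)
      & u = (f * p)%:F / ('X_[e] : S)%:F].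

(* Cech 1-cocycles and 1-coboundaries of O_C for the standard affine open cover
   (C :&: D_+(x_i))_i.  Cochains are given by representatives in K, the
   identities between them being read modulo the ideal sheaf; a 1-cochain is
   indexed by all ordered pairs (i, j), its value there being a section over
   D_+(x_i x_j). *)
Definition cech_cocycle1 (c : 'M[K]_N) : Prop :=
  (forall i j, proj_section [set i; j] (c i j)) /\
  (forall i j l, ideal_section [set i; j; l] (c j l - c i l + c i j)).

Definition cech_coboundary1 (c : 'M[K]_N) : Prop :=
  exists b : 'I_N -> K,
    (forall i, proj_section [set i] (b i)) /\
    (forall i j, ideal_section [set i; j] (c i j - (b j - b i))).

(* The k-vector space H^1(C, O_C), that is cocycles modulo coboundaries, has a
   basis consisting of the classes of g cocycles z_0, ..., z_(g-1). *)
Definition dim_H1_structure_sheaf (g : nat) : Prop :=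
  exists z : 'I_g -> 'M[K]_N,
    (forall s, cech_cocycle1 (z s)) /\
    (forall c, cech_cocycle1 c ->
       exists! a : 'rV[k]_g,
         cech_coboundary1 (c - \sum_(s < g) ((a 0 s)%:MP : S)%:F *: z s)).

(* The genus of a (smooth, connected, projective) curve C over an algebraically
   closed field is dim_k H^1(C, O_C). *)
Definition has_genus (g : nat) : Prop := dim_H1_structure_sheaf g.

End Hypersurface.

Definition weights (m n : nat) : 'I_3 -> nat := tnth [tuple 1%N; m; n].

Definition fermat_poly (k : fieldType) (a m n : nat) : {mpoly k[3]} :=
  'X_(0 : 'I_3) ^+ (a * m * n) + 'X_(1 : 'I_3) ^+ (a * n)
    - 'X_(2 : 'I_3) ^+ (a * m).

Fact fermat_poly_homog (k : fieldType) (a m n : nat) :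
  fermat_poly k a m n \is (a * m * n)%N.-homog for (wdeg (weights m n)).
Proof.
have XnE (i : 'I_3) d : ('X_i : {mpoly k[3]}) ^+ d
    \is (weights m n i * d)%N.-homog for (wdeg (weights m n)).
  rewrite mpolyXn dhomogX /= /wdeg (bigD1 i) //= big1 => [|j ji].
    by rewrite mulmnE mnm1E eqxx mul1n addn0.
  by rewrite mulmnE mnm1E eq_sym (negPf ji) mul0n muln0.
rewrite /fermat_poly rpredB ?rpredD //.
- by have := XnE 0 (a * m * n)%N; rewrite mul1n.
- by have := XnE 1 (a * n)%N; rewrite mulnCA mulnA.
- have w2 : weights m n 2 = n by [].
  by have := XnE 2 (a * m)%N; rewrite w2 [(n * _)%N]mulnC.
Qed.

(* Main.v *)
From HB Require Import structures.
Require Import Defs.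
From mathcomp Require Import all_boot all_order all_algebra zify ring.

Set Implicit Arguments.
Unset Strict Implicit.
Unset Printing Implicit Defensive.

Import GRing.Theory.
Local Open Scope ring_scope.

(* For any nonzero f of degree d in k[x_0, x_1, x_2], the sequence
   0 -> O(- d) -> O -> O_C -> 0 identifies H^1(C, O_C) with H^2(P(w), O(- d)),
   because H^1 and H^2 of O vanish on P(w).  On Cech cochains, a cocycle c is sent
   to h, where c_12 - c_02 + c_01 = f h, and h is read modulo the Laurent
   monomials in which some x_i has a nonnegative exponent.  Hence the genus is the
   number of monomials of degree d with positive exponents.  For the Fermat curve
   these are the lattice points interior to the triangle with vertices (0, 0),
   (a n, 0), (0, a m); they are counted with the central symmetry of the rectangle
   of sides a n and a m, whose diagonal contains a - 1 interior lattice points. *)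

(** * Selection of monomials and homogeneous components *)

Section Filter.
Variables (k : fieldType) (N : nat).
Local Notation S := {mpoly k[N]}.
Implicit Types (p : S) (e t : 'X_{1..N}) (Q : pred 'X_{1..N}).

Definition mpfilter Q p : S := \sum_(t <- msupp p | Q t) p@_t *: 'X_[t].

Lemma mcoeff_mpfilter Q p t : (mpfilter Q p)@_t = if Q t then p@_t else 0.
Proof.
rewrite /mpfilter raddf_sum /=.
have [tp|tp] := boolP (t \in msupp p); last first.
  rewrite (memN_msupp_eq0 tp) if_same big_seq_cond big1 // => s /andP[sp _].
  rewrite mcoeffZ mcoeffX; case: eqP => [st|_]; last by rewrite mulr0.
  by rewrite -st sp in tp.
rewrite big_mkcond (bigD1_seq t) //= big1 ?addr0 => [|s st].
  by case: ifP; rewrite // mcoeffZ mcoeffX eqxx mulr1.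
by case: ifP => // _; rewrite mcoeffZ mcoeffX (negPf st) mulr0.
Qed.

Lemma mpoly_divX e p :
  (forall t, ~~ (e <= t)%MM -> p@_t = 0) -> exists q, p = q * 'X_[e].
Proof.
move=> pe; exists (\sum_(t <- msupp p) p@_t *: 'X_[t - e]).
rewrite mulr_suml [LHS]mpolyE big_seq_cond [RHS]big_seq_cond.
apply: eq_bigr => t /andP[tp _]; rewrite -scalerAl -mpolyXD submK //.
by apply: contraTT tp => /pe pt; rewrite mcoeff_msupp pt eqxx.
Qed.

Lemma mcoeffM_neq0 p q t : (p * q)@_t != 0 ->
  exists t1 t2, [/\ p@_t1 != 0, q@_t2 != 0 & t = (t1 + t2)%MM].
Proof.
rewrite -mcoeff_msupp => /msuppM_le /allpairsP[[t1 t2] /= [t1p t2q ->]].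
by exists t1, t2; rewrite -!mcoeff_msupp.
Qed.

Lemma mcoeffMX_lt p e t : ~~ (e <= t)%MM -> (p * 'X_[e])@_t = 0.
Proof.
apply: contraNeq => /mcoeffM_neq0[t1 [t2 [_ + ->]]].
by rewrite mcoeffX; have [->|_] := eqVneq e t2; rewrite ?lem_addl // eqxx.
Qed.

Variable mf : measure N.

Lemma dhomog_mcoeffP d p :
  p \is d.-homog for mf <-> (forall t, mf t != d -> p@_t = 0).
Proof.
split=> [ph t td|ph]; first by apply: (dhomog_nemf_coeff ph).
apply/dhomogP => t; rewrite mcoeff_msupp => tp; apply/eqP.
by apply: contraR tp => /ph ->.
Qed.

Lemma dhomog_mpfilter Q d p : p \is d.-homog for mf -> mpfilter Q p \is d.-homog for mf.
Proof.
move=> /dhomog_mcoeffP ph; apply/dhomog_mcoeffP => t td.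
by rewrite mcoeff_mpfilter ph // if_same.
Qed.

Lemma dhomog_mulX_inv e d p :
  p * 'X_[e] \is (d + mf e)%N.-homog for mf -> p \is d.-homog for mf.
Proof.
move=> /dhomog_mcoeffP ph; apply/dhomog_mcoeffP => t td.
by rewrite -(mcoeffMX p e) ph // mfD addnC eqn_add2r.
Qed.

(** The terms of p outside degree D - d contribute nothing to g p in degree D. A section of the
    ideal sheaf only comes with f p homogeneous; this makes the cofactor p homogeneous too, without
    cancelling f. *)
Lemma dhomog_mul_mpfilter g d D p : (d <= D)%N ->
  g \is d.-homog for mf -> g * p \is D.-homog for mf ->
  g * p = g * mpfilter (fun t => mf t == (D - d)%N) p.
Proof.
move=> dD gd gpD; apply/mpolyP => t; apply/eqP; rewrite -subr_eq0 -mcoeffB.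
set q := mpfilter _ p; rewrite -mulrBr.
have [tD|tD] := eqVneq (mf t) D.
  apply/contraT => /mcoeffM_neq0[t1 [t2 [gt1 + tE]]].
  have t1d : mf t1 = d.
    by apply/eqP; apply: contraR gt1 => /(dhomog_nemf_coeff gd) ->.
  rewrite mcoeffB mcoeff_mpfilter -tD tE mfD t1d addKn eqxx.
  by rewrite subrr eqxx.
have gqD : g * q \is D.-homog for mf.
  rewrite -(subnKC dD); apply: dhomogM => //.
  by apply/dhomog_mcoeffP => s sD; rewrite mcoeff_mpfilter (negPf sD).
by rewrite mulrBr mcoeffB !(dhomog_nemf_coeff _ tD) // subrr.
Qed.
End Filter.

(** * Sections of the structure and ideal sheaves over a common denominator *)

Section Sections.
Variables (k : fieldType) (N : nat) (w : 'I_N -> nat).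
Local Notation S := {mpoly k[N]}.
Local Notation K := {fraction S}.
Implicit Types (I J : {set 'I_N}) (f g p q h : S) (u v : K) (e t : 'X_{1..N}).

Definition mnm_cst M : 'X_{1..N} := [multinom M | i < N].

Lemma mnm_cstE M i : mnm_cst M i = M.
Proof. by rewrite mnmE. Qed.

Lemma tofracX_neq0 e : ('X_[e] : S)%:F != 0.
Proof. by rewrite tofrac_eq0 -msize_poly_eq0 msizeX. Qed.

Lemma tofrac_divMX p q e :
  (p * 'X_[e])%:F / (q * 'X_[e])%:F = p%:F / q%:F.
Proof. by rewrite !tofracM invfM mulrACA divff ?mulr1 ?tofracX_neq0. Qed.

(* The Laurent polynomial p / (prod_i x_i)^M has no pole along x_i = 0, for all
   i outside of I. *)
Definition poles_in M I p := forall t i, i \notin I -> (t i < M)%N -> p@_t = 0.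

Lemma poles_inD M I p q : poles_in M I p -> poles_in M I q ->
  poles_in M I (p + q).
Proof. by move=> pI qI t i iI tM; rewrite mcoeffD (pI t i) ?(qI t i) ?addr0. Qed.

Lemma poles_in_mpfilter Q M I p : poles_in M I p -> poles_in M I (mpfilter Q p).
Proof. by move=> pI t i iI tM; rewrite mcoeff_mpfilter (pI t i) ?if_same. Qed.

(** For f = 1 the ideal sheaf is O itself, so results on ideal sections apply to both sheaves. *)
Lemma proj_sectionE I u : proj_section w I u <-> ideal_section w 1 I u.
Proof.
by split=> -[e [p [eI pe ->]]]; exists e, p; rewrite mul1r in pe *.
Qed.

Lemma ideal_section_proj f I u : ideal_section w f I u -> proj_section w I u.
Proof. by move=> [e [p [eI pe ->]]]; exists e, (f * p). Qed.

Lemma ideal_sectionS f I J u : I \subset J ->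
  ideal_section w f I u -> ideal_section w f J u.
Proof.
move=> IJ [e [p [eI pe ->]]]; exists e, p; split=> // i ei.
exact: (subsetP IJ) (eI i ei).
Qed.

Lemma ideal_section0 f I : ideal_section w f I 0.
Proof.
exists 0%MM, 0; split; rewrite ?mulr0 ?rpred0 ?tofrac0 ?mul0r //.
by move=> i; rewrite mnm0E.
Qed.

Lemma ideal_sectionN f I u : ideal_section w f I u -> ideal_section w f I (- u).
Proof.
move=> [e [p [eI pe ->]]]; exists e, (- p); rewrite mulrN tofracN mulNr.
by rewrite dhomogN.
Qed.

Lemma ideal_sectionZ f I (a : k) u :
  ideal_section w f I u -> ideal_section w f I ((a%:MP : S)%:F * u).
Proof.
move=> [e [p [eI pe ->]]]; exists e, (a%:MP * p).
rewrite mulrCA; split=> //; first by rewrite mul_mpolyC; apply: rpredZ.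
by rewrite mulrA -tofracM.
Qed.

Hypothesis w_pos : exists i, (0 < w i)%N.

Lemma leq_wdeg_cst M : (M <= wdeg w (mnm_cst M))%N.
Proof.
have [i wi] := w_pos; rewrite /wdeg (bigD1 i) //= mnm_cstE.
by rewrite (leq_trans _ (leq_addr _ _)) // leq_pmull.
Qed.

Variables (d : nat) (f : S).
Hypothesis fd : f \is d.-homog for (wdeg w).

(** Every large M is allowed, so that finitely many sections can share one denominator. *)
Lemma ideal_section_numerator I u : ideal_section w f I u ->
  exists M0, forall M, (M0 <= M)%N ->
  exists p, [/\ p \is (wdeg w (mnm_cst M) - d).-homog for (wdeg w),
                poles_in M I p & u = (f * p)%:F / ('X_[mnm_cst M] : S)%:F].
Proof.
(* Bounding the exponents of e makes x^e divide the new denominator; M >= d keeps the subtraction of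
   d from being truncated. *)
move=> [e [p [eI pe ->]]]; exists (maxn d (\max_i e i)) => M.
rewrite geq_max => /andP[dM eM].
have dD := leq_trans dM (leq_wdeg_cst M).
have eM' : (e <= mnm_cst M)%MM.
  apply/mnm_lepP => i; rewrite mnm_cstE (leq_trans _ eM) //.
  exact: (leq_bigmax (F := e)).
have pD : f * (p * 'X_[mnm_cst M - e]) \is (wdeg w (mnm_cst M)).-homog for (wdeg w).
  rewrite -{2}(submK eM') wdegD addnC mulrA dhomogM //.
  by rewrite dhomogX.
exists (mpfilter (fun t => wdeg w t == wdeg w (mnm_cst M) - d)%N
  (p * 'X_[mnm_cst M - e])).
split.
- by apply/dhomog_mcoeffP => t tD; rewrite mcoeff_mpfilter (negPf tD).
- apply: poles_in_mpfilter => t i iI tM; apply: mcoeffMX_lt.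
  apply/negP => /mnm_lepP/(_ i); rewrite mnmBE mnm_cstE.
  suff -> : e i = 0%N by lia.
  by apply/eqP; apply: contraNT iI => /eI.
- rewrite -(dhomog_mul_mpfilter dD fd pD) mulrA.
  have -> : 'X_[k, mnm_cst M] = 'X_[e] * 'X_[mnm_cst M - e].
    by rewrite -mpolyXD addmC submK.
  by rewrite tofrac_divMX.
Qed.

(** The absence of poles outside I makes p divisible by x^m, where m is M outside I and 0 on I;
    cancelling x^m leaves a denominator supported in I. *)
Lemma ideal_section_intro M I p : (d <= M)%N ->
  p \is (wdeg w (mnm_cst M) - d).-homog for (wdeg w) -> poles_in M I p ->
  ideal_section w f I ((f * p)%:F / ('X_[mnm_cst M] : S)%:F).
Proof.
move=> dM pD pI; pose m : 'X_{1..N} := [multinom if i \in I then 0 else M | i < N]%N.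
have mM : (m <= mnm_cst M)%MM.
  by apply/mnm_lepP => i; rewrite /m !mnmE; case: ifP.
have [|q pq] := @mpoly_divX _ _ m p.
  move=> t /mnm_lepP mt.
  have /existsP[i] : [exists i, ~~ (m i <= t i)%N].
    by apply: contra_notT mt => /existsPn + i => /(_ i); rewrite negbK.
  by rewrite /m mnmE; case: ifP => // iI; rewrite -ltnNge; apply: pI; rewrite iI.
have DE : wdeg w (mnm_cst M) = (wdeg w (mnm_cst M - m)%MM + wdeg w m)%N.
  by rewrite -wdegD submK.
exists (mnm_cst M - m)%MM, q; split.
- by move=> i; rewrite mnmBE /m !mnmE; case: ifP; rewrite ?subnn.
- apply: (@dhomog_mulX_inv _ _ _ m); rewrite -DE -mulrA -pq.
  by rewrite -(subnKC (leq_trans dM (leq_wdeg_cst M))) dhomogM.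
- have -> : 'X_[k, mnm_cst M] = 'X_[mnm_cst M - m] * 'X_[m].
    by rewrite -mpolyXD submK.
  by rewrite pq mulrA tofrac_divMX.
Qed.

Lemma ideal_sectionD I u v : ideal_section w f I u -> ideal_section w f I v ->
  ideal_section w f I (u + v).
Proof.
move=> /ideal_section_numerator[M1 uM] /ideal_section_numerator[M2 vM].
have [|p [pD pI ->]] := uM (maxn d (maxn M1 M2)); first by lia.
have [|q [qD qI ->]] := vM (maxn d (maxn M1 M2)); first by lia.
rewrite -mulrDl -tofracD -mulrDr; apply: ideal_section_intro; first by lia.
  by rewrite rpredD.
exact: poles_inD.
Qed.
End Sections.

(** Each monomial of p has some exponent at least M, say that of x_i, hence no pole along x_i = 0
    after division by (prod_j x_j)^M; it is put into q i for one such i. For N = 3 this splits a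
    section over the triple overlap into sections over the double overlaps. *)
Lemma split_poles (k : fieldType) (N : nat) (mf : measure N) (D M : nat)
    (p : {mpoly k[N]}) :
  p \is D.-homog for mf -> (forall t : 'X_{1..N}, (forall i, (t i < M)%N) -> p@_t = 0) ->
  exists q : 'I_N -> {mpoly k[N]},
    p = \sum_i q i /\
    forall i, q i \is D.-homog for mf /\ poles_in M (~: [set i]) (q i).
Proof.
move=> pD pM; pose Q i (t : 'X_{1..N}) := [pick j | (M <= t j)%N] == Some i.
exists (fun i => mpfilter (Q i) p); split=> [|i]; last first.
  split=> [|t j]; first exact: dhomog_mpfilter.
  rewrite !inE negbK mcoeff_mpfilter /Q => /eqP-> tM; case: eqP => //.
  by case: pickP => // l Ml [lj]; rewrite -lj ltnNge Ml in tM.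
apply/mpolyP => t; rewrite raddf_sum /=.
under eq_bigr do rewrite mcoeff_mpfilter /Q.
case: pickP => [j Mj|tM].
  rewrite (bigD1 j) //= eqxx big1 ?addr0 // => i ij.
  by case: eqP => // -[ji]; rewrite ji eqxx in ij.
by rewrite big1 ?pM // => i; rewrite ltnNge tM.
Qed.

Lemma ord3P (i : 'I_3) : [\/ i = 0, i = 1 | i = 2].
Proof.
case: i => -[|[|[|//]]] ?; [constructor 1|constructor 2|constructor 3];
  exact: val_inj.
Qed.

(** * Cech cochains on P(w) and the connecting homomorphism *)

Section Curves.
Variables (k : fieldType) (w : 'I_3 -> nat).
Hypothesis w_gt0 : forall i, (0 < w i)%N.
Local Notation S := {mpoly k[3]}.
Local Notation K := {fraction S}.

Let w_pos : exists i, (0 < w i)%N.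
Proof. by exists 0. Qed.

Let proj_sectionD I (u v : K) :
  proj_section w I u -> proj_section w I v -> proj_section w I (u + v).
Proof.
rewrite !proj_sectionE; apply: ideal_sectionD => //; exact: dhomog1.
Qed.

Let proj_sectionN I (u : K) : proj_section w I u -> proj_section w I (- u).
Proof. by rewrite !proj_sectionE; apply: ideal_sectionN. Qed.

Let proj_sectionB I (u v : K) :
  proj_section w I u -> proj_section w I v -> proj_section w I (u - v).
Proof. by move=> uI vI; apply/proj_sectionD/proj_sectionN. Qed.

Lemma proj_section_numerator I (u : K) : proj_section w I u ->
  exists M0, forall M, (M0 <= M)%N ->
  exists p : S, [/\ p \is (wdeg w (mnm_cst 3 M)).-homog for (wdeg w),
                poles_in M I p & u = p%:F / ('X_[mnm_cst 3 M] : S)%:F].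
Proof.
move=> /proj_sectionE/(ideal_section_numerator w_pos (dhomog1 _ _))[M0 uM].
exists M0 => M /uM[p [pD pI ->]]; exists p.
by rewrite mul1r; split=> //; rewrite subn0 in pD.
Qed.

Lemma proj_section_intro M I (p : S) :
  p \is (wdeg w (mnm_cst 3 M)).-homog for (wdeg w) -> poles_in M I p ->
  proj_section w I (p%:F / ('X_[mnm_cst 3 M] : S)%:F).
Proof.
move=> pD pI; apply/proj_sectionE; rewrite -[p]mul1r.
by apply: (ideal_section_intro w_pos (dhomog1 _ _)); rewrite ?subn0.
Qed.

(** This is H^1(P(w), O) = 0. The part of c01 with a pole along x_0 = 0 becomes - b_0; what it
    leaves of c01 and c02 has poles only along x_1 = 0 and x_2 = 0 respectively, and gives b_1 and
    b_2. *)
Lemma proj_H1_eq0 (c01 c02 c12 : K) :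
  proj_section w [set 0; 1] c01 -> proj_section w [set 0; 2] c02 ->
  proj_section w [set 1; 2] c12 -> c12 - c02 + c01 = 0 ->
  exists b : 'I_3 -> K, (forall i, proj_section w [set i] (b i)) /\
    [/\ c01 = b 1 - b 0, c02 = b 2 - b 0 & c12 = b 2 - b 1].
Proof.
move=> /proj_section_numerator[M1 p01P] /proj_section_numerator[M2 p02P].
move=> /proj_section_numerator[M3 p12P].
pose M := (M1 + M2 + M3)%N.
have [|p [pD pI c01E]] := p01P M; first by rewrite /M; lia.
have [|q [qD qI c02E]] := p02P M; first by rewrite /M; lia.
have [|r [rD rI c12E]] := p12P M; first by rewrite /M; lia.
rewrite {}c01E {}c02E {}c12E.
set X := ('X_[_])%:F; have X0 : X != 0 by exact: tofracX_neq0.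
rewrite -!mulrBl -!mulrDl -tofracB -tofracD => /eqP.
rewrite mulf_eq0 invr_eq0 (negPf X0) orbF tofrac_eq0 => /eqP rqp.
have {}rqp : r = q - p by rewrite -[LHS]subr0 -rqp; ring.
(* In p, a monomial with a pole along x_0 = 0 also occurs in q, hence has no
   pole along x_1 = 0. *)
pose s := mpfilter (fun t : 'X_{1..3} => t 0%R < M)%N p.
have sD : s \is (wdeg w (mnm_cst 3 M)).-homog for (wdeg w) by exact: dhomog_mpfilter.
have qpE (t : 'X_{1..3}) : (t 0%R < M)%N -> q@_t = p@_t.
  by move=> tM; apply/eqP; rewrite -subr_eq0 -mcoeffB -rqp (rI t 0%R) ?inE.
pose b i : S := if i == 0 :> 'I_3 then - s else if i == 1 then p - s else q - s.
exists (fun i => (b i)%:F / X); split; last first.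
  rewrite /b /= -!mulrBl -!tofracB; split; congr (_%:F / _); rewrite ?rqp; ring.
move=> i; apply: proj_section_intro.
  by rewrite /b; case: ifP => _; [|case: ifP => _]; rewrite ?rpredN ?rpredB.
have p2 (t : 'X_{1..3}) : (t 2%R < M)%N -> p@_t = 0 by apply: pI; rewrite !inE.
have q1 (t : 'X_{1..3}) : (t 1%R < M)%N -> q@_t = 0 by apply: qI; rewrite !inE.
have s0 (t : 'X_{1..3}) : (t 0%R < M)%N -> s@_t = p@_t.
  by move=> tM; rewrite mcoeff_mpfilter tM.
have s1 (t : 'X_{1..3}) : (t 1%R < M)%N -> s@_t = 0.
  by move=> tM; rewrite mcoeff_mpfilter; case: ifP => // /qpE <-; exact: q1.
have s2 (t : 'X_{1..3}) : (t 2%R < M)%N -> s@_t = 0.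
  by move=> tM; rewrite mcoeff_mpfilter p2 // if_same.
move=> t j; rewrite inE /b.
by case: (ord3P i) => ->; case: (ord3P j) => -> //= _ tM; rewrite ?mcoeffB ?mcoeffN;
  rewrite ?(s1 t tM) ?(s2 t tM) ?(s0 t tM) ?(p2 t tM) ?(q1 t tM) ?(qpE t tM)
    ?subrr ?oppr0.
Qed.

Variables (d : nat) (f : S).
Hypothesis fd : f \is d.-homog for (wdeg w).

Let ideal_sectionB I (u v : K) :
  ideal_section w f I u -> ideal_section w f I v -> ideal_section w f I (u - v).
Proof.
by move=> uI vI; apply: (ideal_sectionD w_pos fd) => //; apply: ideal_sectionN.
Qed.

Lemma cech_cocycle1D (c1 c2 : 'M[K]_3) :
  cech_cocycle1 w f c1 -> cech_cocycle1 w f c2 -> cech_cocycle1 w f (c1 + c2).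
Proof.
move=> [c1P c1I] [c2P c2I]; split=> [i j|i j l].
  by rewrite !mxE; apply: proj_sectionD.
rewrite !mxE [X in ideal_section _ _ _ X](_ : _ =
  (c1 j l - c1 i l + c1 i j) + (c2 j l - c2 i l + c2 i j)); last by ring.
exact: (ideal_sectionD w_pos fd).
Qed.

Lemma cech_cocycle1Z (a : k) (c : 'M[K]_3) :
  cech_cocycle1 w f c -> cech_cocycle1 w f ((a%:MP : S)%:F *: c).
Proof.
move=> [cP cI]; split=> [i j|i j l].
  by rewrite !mxE; apply/proj_sectionE/ideal_sectionZ/proj_sectionE.
by rewrite !mxE -mulrBr -mulrDr; apply: ideal_sectionZ.
Qed.

Definition cech_d012 (c : 'M[K]_3) : K := c 1 2 - c 0 2 + c 0 1.

Lemma cech_d012_is_zmod_morphism : zmod_morphism cech_d012.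
Proof. by move=> c1 c2; rewrite /cech_d012 !mxE; ring. Qed.

HB.instance Definition _ := GRing.isZmodMorphism.Build 'M[K]_3 K cech_d012
  cech_d012_is_zmod_morphism.

Lemma cech_d012Z (x : K) (c : 'M[K]_3) : cech_d012 (x *: c) = x * cech_d012 c.
Proof. by rewrite /cech_d012 !mxE; ring. Qed.

Let setC10 : ~: [set 0] = [set 1; 2] :> {set 'I_3}.
Proof. by apply/setP => i; rewrite !inE; case: (ord3P i) => ->. Qed.

Let setC11 : ~: [set 1] = [set 0; 2] :> {set 'I_3}.
Proof. by apply/setP => i; rewrite !inE; case: (ord3P i) => ->. Qed.

Let setC12 : ~: [set 2] = [set 0; 1] :> {set 'I_3}.
Proof. by apply/setP => i; rewrite !inE; case: (ord3P i) => ->. Qed.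

Let sum3 (V : nmodType) (F : 'I_3 -> V) : \sum_i F i = F 0 + F 1 + F 2.
Proof.
by rewrite !big_ord_recr big_ord0 /= add0r; congr (F _ + F _ + F _); exact: val_inj.
Qed.

(** Injectivity of the connecting homomorphism. Correcting the c_ij by the h i, which vanish on C,
    gives an honest cocycle of O on P(w), to which [proj_H1_eq0] applies. *)
Lemma cech_cocycle1_exact (c : 'M[K]_3) (h : 'I_3 -> K) :
  cech_cocycle1 w f c -> (forall i, ideal_section w f (~: [set i]) (h i)) ->
  cech_d012 c = \sum_i h i -> cech_coboundary1 w f c.
Proof.
move=> [cP cI] hI; rewrite sum3 /cech_d012 => cE.
have [h0 h1 h2] : [/\ ideal_section w f [set 1; 2] (h 0),
    ideal_section w f [set 0; 2] (h 1) & ideal_section w f [set 0; 1] (h 2)].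
  by rewrite -setC10 -setC11 -setC12.
have hP i := ideal_section_proj (hI i).
have [||||b [bP [b01 b02 b12]]] := @proj_H1_eq0 (c 0 1 - h 2) (c 0 2 + h 1) (c 1 2 - h 0).
- by apply: proj_sectionB => //; rewrite -setC12.
- by apply: proj_sectionD => //; rewrite -setC11.
- by apply: proj_sectionB => //; rewrite -setC10.
- by rewrite [LHS](_ : _ = c 1 2 - c 0 2 + c 0 1 - (h 0 + h 1 + h 2));
    [rewrite cE subrr|ring].
exists b; split=> //.
(* Cochains are indexed by all ordered pairs: the diagonal and reversed pairs follow from the
   cocycle condition at (i, i, i) and (i, j, i). *)
pose R i j := ideal_section w f [set i; j] (c i j - (b j - b i)).
have cii i : ideal_section w f [set i] (c i i).
  by have := cI i i i; rewrite subrr add0r !setUid.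
have Rii i : R i i by rewrite /R setUid !subrr subr0.
have Rsym i j : R i j -> R j i.
  rewrite /R => Rij; rewrite [X in ideal_section _ _ _ X](_ : _ =
    (c j i - c i i + c i j) + c i i - (c i j - (b j - b i))); last by ring.
  apply: ideal_sectionB; last by rewrite setUC.
  apply: (ideal_sectionD w_pos fd) => //.
    by apply: ideal_sectionS (cI i j i); apply/subsetP => l; rewrite !inE; lia.
  by apply: ideal_sectionS (cii i); apply/subsetP => l; rewrite !inE; lia.
have R01 : R 0 1 by rewrite /R -b01 opprB addrCA subrr addr0.
have R02 : R 0 2 by rewrite /R -b02 opprD addrA subrr add0r; apply: ideal_sectionN.
have R12 : R 1 2 by rewrite /R -b12 opprB addrCA subrr addr0.
by move=> i j; case: (ord3P i) => ->; case: (ord3P j) => ->; try exact: Rii;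
  by [|apply: Rsym].
Qed.

(** The b_i cancel in the alternating sum, leaving only the corrections in the ideal sheaf. *)
Lemma cech_coboundary1_d012 (c : 'M[K]_3) : cech_coboundary1 w f c ->
  exists h : 'I_3 -> K, (forall i, ideal_section w f (~: [set i]) (h i)) /\
    cech_d012 c = \sum_i h i.
Proof.
move=> [b [_ bI]]; pose r i j := c i j - (b j - b i).
exists (fun i => if i == 0 :> 'I_3 then r 1 2 else if i == 1 then - r 0 2 else r 0 1).
split=> [i|]; last by rewrite sum3 /cech_d012 /r /=; ring.
case: (ord3P i) => -> /=; rewrite ?setC10 ?setC11 ?setC12; try exact: bI.
exact: ideal_sectionN.
Qed.

(** Surjectivity of the connecting homomorphism: up to sign, u i is the value of the cocycle on the
    pair complementary to i. *)
Lemma cech_cocycle1_lift (u : 'I_3 -> K) :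
  (forall i, proj_section w (~: [set i]) (u i)) ->
  ideal_section w f setT (\sum_i u i) ->
  exists z, cech_cocycle1 w f z /\ cech_d012 z = \sum_i u i.
Proof.
move=> uP; rewrite sum3 => uI.
have [u0 u1 u2] : [/\ proj_section w [set 1; 2] (u 0),
    proj_section w [set 0; 2] (u 1) & proj_section w [set 0; 1] (u 2)].
  by rewrite -setC10 -setC11 -setC12.
(* Addition in ['I_3] is modulo 3, so j + 1 (or i + 1) is the third index, and the sign records the
   cyclic order of the pair. *)
pose z : 'M[K]_3 := \matrix_(i, j)
  (if j == i + 1 then u (j + 1) else if i == j + 1 then - u (i + 1) else 0).
have zE : [/\ z 0 1 = u 2, z 1 2 = u 0 & z 0 2 = - u 1].
  by rewrite !mxE /=; split; congr (u _) || congr (- u _); exact: val_inj.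
have zN i j : z j i = - z i j.
  rewrite !mxE; case: (ord3P i) => ->; case: (ord3P j) => -> /=;
  by rewrite ?oppr0 ?opprK.
case: zE => z01 z12 z02; have zii i : z i i = 0.
  by rewrite !mxE; case: (ord3P i) => ->.
exists z; split; last by rewrite /cech_d012 z01 z12 z02; ring.
have z10 : z 1 0 = - u 2 by rewrite zN z01.
have z21 : z 2 1 = - u 0 by rewrite zN z12.
have z20 : z 2 0 = u 1 by rewrite zN z02 opprK.
have p0 I : proj_section w I 0 by apply/proj_sectionE/ideal_section0.
split=> [i j|i j l].
  case: (ord3P i) => ->; case: (ord3P j) => ->;
    rewrite ?zii ?z01 ?z02 ?z12 ?z10 ?z20 ?z21 //; do ?[exact: proj_sectionN];
    by rewrite setUC //; exact: proj_sectionN.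
(* By antisymmetry the differential vanishes on triples with a repetition; on the others it is the
   sum of the u i up to sign. *)
have [ij|ij] := eqVneq i j.
  by rewrite ij zii subrr addr0; apply: ideal_section0.
have [jl|jl] := eqVneq j l.
  by rewrite jl zii sub0r addNr; apply: ideal_section0.
have [il|il] := eqVneq i l.
  by rewrite il zii subr0 (zN j l) subrr; apply: ideal_section0.
have -> : [set i; j; l] = setT.
  apply/setP => s; rewrite !inE; move: ij jl il.
  by case: (ord3P i) => ->; case: (ord3P j) => ->; case: (ord3P l) => ->;
    case: (ord3P s) => ->.
suff [->|->] : z j l - z i l + z i j = u 0 + u 1 + u 2 \/
    z j l - z i l + z i j = - (u 0 + u 1 + u 2) => //.
  exact: ideal_sectionN.
move: ij jl il; case: (ord3P i) => ->; case: (ord3P j) => ->; case: (ord3P l) => -> //;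
  rewrite ?zii ?z01 ?z02 ?z12 ?z10 ?z20 ?z21 => _ _ _; by [left; ring|right; ring].
Qed.

End Curves.

(** * The basis of H^1(C, O_C) given by monomials *)

Section Genus.
Variables (k : fieldType) (w : 'I_3 -> nat).
Hypothesis w_gt0 : forall i, (0 < w i)%N.
Local Notation S := {mpoly k[3]}.
Local Notation K := {fraction S}.

Let w_pos : exists i, (0 < w i)%N.
Proof. by exists 0. Qed.

(** So no Laurent monomial of degree 0 has only negative exponents, which is H^2(P(w), O) = 0. *)
Lemma ltn_wdeg_cst M (t : 'X_{1..3}) :
  (forall i, (t i < M)%N) -> (wdeg w t < wdeg w (mnm_cst 3 M))%N.
Proof.
move=> tM; rewrite /wdeg !(bigD1 0 (P := xpredT)) //= -addSn leq_add //.
  by rewrite mnm_cstE ltn_pmul2l.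
by apply: leq_sum => i _; rewrite mnm_cstE leq_mul2l (ltnW (tM i)) orbT.
Qed.

Variables (d : nat) (f : S).
Hypotheses (fd : f \is d.-homog for (wdeg w)) (f0 : f != 0).
Variables (g : nat) (mu : 'I_g -> 'X_{1..3}).
Hypotheses (mu_inj : injective mu)
  (muP : forall e : 'X_{1..3},
     ((forall i, (0 < e i)%N) /\ wdeg w e = d) <-> exists s, mu s = e).

Let mu_gt0 s i : (0 < mu s i)%N.
Proof. by have [+ _] : _ /\ _ := (muP (mu s)).2 (ex_intro _ s erefl); apply. Qed.

Let mu_deg s : wdeg w (mu s) = d.
Proof. by have [_] : _ /\ _ := (muP (mu s)).2 (ex_intro _ s erefl). Qed.

Let mu_le s M : (d <= M)%N -> (mu s <= mnm_cst 3 M)%MM.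
Proof.
move=> dM; apply/mnm_lepP => i; rewrite mnm_cstE (leq_trans _ dM) //.
rewrite -(mu_deg s) /wdeg (bigD1 i) //=.
by rewrite (leq_trans _ (leq_addr _ _)) // leq_pmull.
Qed.

Let frac_muE s M : (d <= M)%N ->
  f%:F / ('X_[mu s] : S)%:F =
  (f * 'X_[mnm_cst 3 M - mu s])%:F / ('X_[mnm_cst 3 M] : S)%:F.
Proof.
move=> dM; rewrite -(tofrac_divMX _ _ (mnm_cst 3 M - mu s)) -mpolyXD.
by rewrite addmC submK ?mu_le.
Qed.

(* The cocycle z s goes to the class of x^(- mu s) under the isomorphism
   H^1(C, O_C) = H^2(P(w), O(- d)). *)
Lemma cech_basis : exists z : 'I_g -> 'M[K]_3,
  forall s, cech_cocycle1 w f (z s) /\ cech_d012 (z s) = f%:F / ('X_[mu s] : S)%:F.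
Proof.
suff zP s : exists z, cech_cocycle1 w f z /\ cech_d012 z = f%:F / ('X_[mu s] : S)%:F.
  by have [z] := fin_all_exists zP; exists z.
(* As the weights are positive, no exponent in [mu s] exceeds d, so M = d suffices. *)
pose M := d; pose p := f * 'X_[mnm_cst 3 M - mu s].
have pD : p \is (wdeg w (mnm_cst 3 M)).-homog for (wdeg w).
  rewrite -(submK (mu_le s (leqnn d))) wdegD mu_deg addnC dhomogM //.
  by rewrite dhomogX.
have [|q [pE qP]] := split_poles (M := M) pD.
  by move=> t /ltn_wdeg_cst; rewrite ltn_neqAle => /andP[+ _]; apply: dhomog_nemf_coeff.
pose u i : K := (q i)%:F / ('X_[mnm_cst 3 M] : S)%:F.
have uE : \sum_i u i = f%:F / ('X_[mu s] : S)%:F.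
  by rewrite -mulr_suml -rmorph_sum -pE (frac_muE s (leqnn d)).
have [||z [zC zE]] := cech_cocycle1_lift (w := w) (f := f) (u := u).
- by move=> i; have [qD qI] := qP i; apply: proj_section_intro.
- rewrite uE; exists (mu s), 1; rewrite mulr1 mu_deg; split=> // i.
  by rewrite inE.
- by exists z; rewrite zE uE.
Qed.

(** Over the denominator (x_0 x_1 x_2)^M, t stands for a Laurent monomial of degree - d with
    negative exponents; its inverse is one of the monomials enumerated by [mu]. *)
Let mnm_boxP M (t : 'X_{1..3}) : (d <= M)%N ->
  wdeg w t = (wdeg w (mnm_cst 3 M) - d)%N -> (forall i, (t i < M)%N) ->
  exists s, t = (mnm_cst 3 M - mu s)%MM.
Proof.
move=> dM tD tM; have tle : (t <= mnm_cst 3 M)%MM.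
  by apply/mnm_lepP => i; rewrite mnm_cstE ltnW.
have [|s sE] := (muP (mnm_cst 3 M - t)%MM).1.
  split=> [i|]; first by rewrite mnmBE mnm_cstE subn_gt0.
  apply/eqP; rewrite -(eqn_add2r (wdeg w t)) -wdegD submK // tD subnKC //.
  exact: leq_trans dM (leq_wdeg_cst w_pos M).
by exists s; rewrite sE; apply/mnmP => i; rewrite !mnmBE mnm_cstE subKn // ltnW.
Qed.

Let box_inj M s s' : (d <= M)%N ->
  ((mnm_cst 3 M - mu s)%MM == (mnm_cst 3 M - mu s')%MM) = (s == s').
Proof.
move=> dM; apply/eqP/eqP => [E|-> //]; apply: mu_inj; apply/mnmP => i.
move/mnmP/(_ i): E; rewrite !mnmBE mnm_cstE.
have /mnm_lepP/(_ i) := mu_le s dM; have /mnm_lepP/(_ i) := mu_le s' dM.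
by rewrite mnm_cstE; lia.
Qed.

Theorem genus_curve : has_genus w f g.
Proof.
have [z zP] := cech_basis; exists z; split=> [s|]; first by case: (zP s).
pose Z (a : 'rV[k]_g) := \sum_(s < g) ((a 0 s)%:MP : S)%:F *: z s.
(* The numerator of the combination of the x^(- mu s) with coefficients a. *)
pose T M (a : 'rV[k]_g) : S := \sum_s a 0 s *: 'X_[mnm_cst 3 M - mu s].
have ZE M a : (d <= M)%N ->
    cech_d012 (Z a) = (f * T M a)%:F / ('X_[mnm_cst 3 M] : S)%:F.
  move=> dM; rewrite /Z raddf_sum /= /T mulr_sumr rmorph_sum mulr_suml /=.
  apply: eq_bigr => s _; rewrite cech_d012Z (zP s).2 (frac_muE s dM) mulrA.
  by rewrite -tofracM -mul_mpolyC mulrCA.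
have TE M a s : (d <= M)%N -> (T M a)@_(mnm_cst 3 M - mu s) = a 0 s.
  move=> dM; rewrite /T raddf_sum (bigD1 s) //= big1 => [|s' ss'].
    by rewrite mcoeffZ mcoeffX eqxx mulr1 addr0.
  by rewrite mcoeffZ mcoeffX box_inj // (negPf ss') mulr0.
have ZC a : cech_cocycle1 w f (Z a).
  rewrite /Z; apply: big_ind => [|c1 c2|s _].
  - by split=> [i j|i j l]; rewrite !mxE ?subrr ?addr0;
      [apply/proj_sectionE|]; apply: ideal_section0.
  - exact: (cech_cocycle1D w_gt0 fd).
  - by apply: cech_cocycle1Z; case: (zP s).
have ZD a a' : Z (a - a') = Z a - Z a'.
  rewrite /Z -sumrB; apply: eq_bigr => s _.
  by rewrite !mxE mpolyCB tofracB scalerBl.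
(* Linear independence: after cancelling f, [T M a] is a sum of p i without pole along x_i = 0,
   whereas every exponent of M - mu s is below M, so its coefficient vanishes in each p i. *)
have Z_inj a (v : 'I_3 -> K) : (forall i, ideal_section w f (~: [set i]) (v i)) ->
    cech_d012 (Z a) = \sum_i v i -> a = 0.
  move=> vI Zv; have /fin_all_exists[M0 vP] :=
    fun i => ideal_section_numerator w_pos fd (vI i).
  pose M := (d + \sum_i M0 i)%N; have dM : (d <= M)%N by rewrite leq_addr.
  have M0_le i : (M0 i <= M)%N by rewrite /M (bigD1 i) //= addnCA leq_addr.
  have /fin_all_exists[p pP] := fun i => vP i M (M0_le i).
  set X := ('X_[mnm_cst 3 M] : S)%:F in pP; have X0 : X != 0 by exact: tofracX_neq0.
  have TpE : T M a = \sum_i p i.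
    apply: (mulfI f0); apply/eqP; rewrite -tofrac_eq; apply/eqP.
    apply: (mulIf (invr_neq0 X0)); rewrite -ZE // Zv mulr_sumr rmorph_sum mulr_suml.
    by apply: eq_bigr => i _; have [_ _ ->] := pP i.
  apply/rowP => s; rewrite mxE -(TE M a s dM) TpE raddf_sum big1 //= => i _.
  have [_ pI _] := pP i; apply: (pI _ i); first by rewrite !inE eqxx.
  rewrite mnmBE mnm_cstE ltn_subrL mu_gt0 (leq_trans (mu_gt0 s i)) //.
  by have /mnm_lepP/(_ i) := mu_le s dM; rewrite mnm_cstE.
move=> c cC.
have [M0 hP] := ideal_section_numerator w_pos fd (cC.2 0 1 2).
pose M := maxn d M0; have dM : (d <= M)%N by rewrite leq_maxl.
have [|h [hD _ hE]] := hP M; first by rewrite leq_maxr.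
(* The coordinates of c are the coefficients of h at the monomials with three poles; once these are
   removed, [split_poles] applies to the rest. *)
pose a : 'rV[k]_g := \row_s h@_(mnm_cst 3 M - mu s).
have hTD : h - T M a \is (wdeg w (mnm_cst 3 M) - d).-homog for (wdeg w).
  rewrite rpredB // rpred_sum // => s _; rewrite rpredZ // dhomogX.
  by rewrite -{2}(submK (mu_le s dM)) wdegD mu_deg addnK.
have [t tM|q [qE qP]] := split_poles (M := M) hTD.
  have [tD|tD] := eqVneq (wdeg w t) (wdeg w (mnm_cst 3 M) - d)%N.
    by have [s ->] := mnm_boxP dM tD tM; rewrite mcoeffB TE // mxE subrr.
  exact: dhomog_nemf_coeff hTD tD.
have aP : cech_coboundary1 w f (c - Z a).
  apply: (cech_cocycle1_exact w_gt0 fd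
    (h := fun i => (f * q i)%:F / ('X_[mnm_cst 3 M] : S)%:F)).
  - apply: (cech_cocycle1D w_gt0 fd) => //.
    have -> : - Z a = ((-1)%:MP : S)%:F *: Z a.
      by rewrite mpolyCN tofracN mpolyC1 tofrac1 scaleN1r.
    exact: cech_cocycle1Z.
  - by move=> i; have [qD qI] := qP i; apply: (ideal_section_intro w_pos fd dM).
  - rewrite raddfB /= (ZE M a dM) {1}/cech_d012 hE -mulrBl -tofracB -mulrBr qE.
    by rewrite mulr_sumr rmorph_sum mulr_suml.
exists a; split=> // a' a'P.
(* Uniqueness: the difference of the two coboundaries is Z (a - a'), to which [Z_inj] applies. *)
have [v [vI vE]] := cech_coboundary1_d012 aP.
have [v' [v'I v'E]] := cech_coboundary1_d012 a'P.
apply/eqP; rewrite -subr_eq0; apply/eqP.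
apply: (Z_inj _ (fun i => v' i - v i)) => [i|].
  by apply: (ideal_sectionD w_pos fd) => //; apply: ideal_sectionN.
rewrite sumrB -vE -v'E -raddfB ZD; congr cech_d012.
by rewrite opprB [RHS]addrC addrA subrK.
Qed.
End Genus.

(** * Lattice points below the diagonal of a rectangle *)

Section LatticePoints.
Variables (a m n : nat).
Hypotheses (a_gt0 : (0 < a)%N) (m_gt0 : (0 < m)%N) (n_gt0 : (0 < n)%N).

(* The pair (i, j) stands for the point (i + 1, j + 1), so that [rev_ord] is
   the central symmetry of the rectangle of the points (x, y) with
   0 < x < a n and 0 < y < a m. *)
Local Notation rect := ('I_(a * n).-1 * 'I_(a * m).-1)%type.

(** The line m x + n y = a m n joins the corners (a n, 0) and (0, a m) of the rectangle. *)
Definition triangle : {set rect} :=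
  [set x : rect | m * x.1.+1 + n * x.2.+1 < a * m * n]%N.

Definition diagonal : {set rect} :=
  [set x : rect | m * x.1.+1 + n * x.2.+1 == a * m * n]%N.

(** Since n divides m x, coprimality gives x = n t, hence y = m (a - t), with 0 < t < a. *)
Lemma card_diagonal : coprime m n -> #|diagonal| = a.-1.
Proof.
move=> mn.
have lt1 (t : 'I_a.-1) : ((n * t.+1).-1 < (a * n).-1)%N by case: t => t /=; nia.
have lt2 (t : 'I_a.-1) : ((m * (a.-1 - t)).-1 < (a * m).-1)%N by case: t => t /=; nia.
(* The index t stands for t + 1, so F t is the point (n (t + 1), m (a - (t + 1))). *)
pose F t : rect := (Ordinal (lt1 t), Ordinal (lt2 t)).
have F_inj : injective F.
  by move=> t t' [E _]; apply: val_inj => /=; case: t t' E => t ? [t' ?] /=; nia.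
rewrite -[RHS]card_ord -(card_imset _ F_inj); apply: eq_card => x.
rewrite inE; apply/eqP/imsetP => [xE|[t _ ->] /=]; last first.
  by case: t => t /= ta; nia.
have : (n %| x.1.+1)%N.
  rewrite -(Gauss_dvdr _ (n := m)) 1?coprime_sym //.
  by rewrite -(dvdn_addl _ (dvdn_mulr x.2.+1 (dvdnn n))) xE dvdn_mull.
move=> /dvdnP[t tE]; case: x tE xE => [[x1 l1] [x2 l2]] /= tE xE.
have t0 : (0 < t)%N by case: t tE.
have ta : (t < a)%N by rewrite -(ltn_pmul2r n_gt0) -tE; lia.
have ta1 : (t.-1 < a.-1)%N by lia.
have x2E : x2.+1 = (m * (a - t))%N.
  by apply/eqP; rewrite -(eqn_pmul2l n_gt0); apply/eqP; rewrite tE in xE; nia.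
have x1E : x1 = (n * t).-1 by rewrite mulnC -tE.
exists (Ordinal ta1) => //; congr pair; apply: val_inj => /=; rewrite ?prednK //.
by rewrite (_ : a.-1 - t.-1 = a - t)%N -?x2E //; lia.
Qed.

(** The values of m x + n y at a point and at its mirror image add up to 2 a m n, so the complement
    of the triangle is the disjoint union of its mirror image and the diagonal. *)
Lemma card_triangle : coprime m n ->
  ((a * n).-1 * (a * m).-1 = (#|triangle|).*2 + a.-1)%N.
Proof.
move=> mn; have <- : #|{: rect}| = ((a * n).-1 * (a * m).-1)%N.
  by rewrite card_prod !card_ord.
pose r (x : rect) : rect := (rev_ord x.1, rev_ord x.2).
have rK : involutive r by case=> x y; rewrite /r /= !rev_ordK.
have rE x : (m * (r x).1.+1 + n * (r x).2.+1 + (m * x.1.+1 + n * x.2.+1)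
    = (a * m * n).*2)%N.
  case: x => [[x l] [y l']] /=; rewrite addnACA -!mulnDr.
  have -> : (((a * n).-1 - x.+1).+1 + x.+1 = a * n)%N by lia.
  have -> : (((a * m).-1 - y.+1).+1 + y.+1 = a * m)%N by lia.
  by rewrite -addnn; congr addn; lia.
rewrite -(cardC (mem triangle)) -addnn -addnA; congr (_ + _)%N.
rewrite -(card_diagonal mn) -(card_imset (mem triangle) (inv_inj rK)) -cardsUI.
have -> : (r @: triangle) :&: diagonal = set0.
  apply/setP => x; rewrite (can_imset_pre _ rK) !inE.
  by have := rE x; lia.
rewrite cards0 addn0; apply: eq_card => x.
rewrite !inE (can_imset_pre _ rK) !inE; have := rE x; lia.
Qed.
End LatticePoints.

(** * Genus of the Fermat-type curve *)

Theorem theorem5p5 (k : closedFieldType) (hk : [pchar k] =i pred0)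
    (a m n : nat) (ha : (0 < a)%N) (hm : (0 < m)%N) (hmn : (m < n)%N)
    (hcop : coprime m n) :
  exists g : nat,
    has_genus (weights m n) (fermat_poly k a m n) g /\
    (g%:R : rat) =
      ((a%:R * m%:R - 1) * (a%:R * n%:R - 2) + a%:R * (m%:R - 1)) / 2.
Proof.
have hn : (0 < n)%N by apply: leq_trans hmn.
exists #|triangle a m n|; split; last first.
  (* The numerator (a m - 1)(a n - 2) + a (m - 1) equals (a n - 1)(a m - 1) - (a - 1). *)
  have := card_triangle ha hm hn hcop.
  move: #|triangle a m n| => g /(congr1 (fun x : nat => x%:R : rat)).
  rewrite -muln2 natrD !natrM -!subn1 !natrB ?muln_gt0 ?ha // !natrM => E.
  have -> : g%:R = (g%:R * 2 + (a%:R - 1) - (a%:R - 1)) / 2 :> rat by field.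
  by rewrite -E; field.
(* As x_0 has weight 1, its exponent is determined by the other two; it is positive exactly inside
   the triangle. *)
pose mu (s : 'I_#|triangle a m n|) : 'X_{1..3} :=
  let x := enum_val s in
  Multinom [tuple (a * m * n - (m * x.1.+1 + n * x.2.+1))%N; x.1.+1; x.2.+1].
have wE (e : 'X_{1..3}) : wdeg (weights m n) e = (e 0%R + m * e 1%R + n * e 2%R)%N.
  rewrite /wdeg !big_ord_recr big_ord0 /= add0n mul1n.
  by congr (e _ + _ * e _ + _ * e _)%N; apply: val_inj.
have muE s : let x := enum_val s in
    [/\ mu s 0 = (a * m * n - (m * x.1.+1 + n * x.2.+1))%N,
        mu s 1 = x.1.+1 & mu s 2 = x.2.+1] by [].
apply: (@genus_curve k _ _ (a * m * n) _ (fermat_poly_homog k a m n) _ _ mu).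
- by move=> i; case: (ord3P i) => ->.
(* The polynomial takes the value 1 at (1, 0, 0), so it is nonzero. *)
- apply/eqP => /(congr1 (meval (fun i : 'I_3 => (i == 0)%:R))).
  rewrite /fermat_poly rmorphB rmorphD !rmorphXn /= !mevalXU meval0 /=.
  by rewrite expr1n !expr0n !muln_eq0 !gtn_eqF //= subr0 addr0 => /eqP; rewrite oner_eq0.
- move=> s s' E; apply: enum_val_inj.
  have [_ E1 E2] := muE s; have [_ E1' E2'] := muE s'.
  rewrite E in E1 E2; case: (enum_val s) (enum_val s') E1 E2 E1' E2' => x y [x' y'] /=.
  move=> -> -> [xx'] [yy'].
  by congr pair; apply: val_inj.
move=> e; rewrite wE; split=> [[e_gt0 eE]|[s <-]]; last first.
  have [-> -> ->] := muE s; have := enum_valP s; rewrite inE => slt.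
  split; last by rewrite -addnA subnK // ltnW.
  have [E0 E1 E2] := muE s => i.
  by case: (ord3P i) => ->; rewrite ?E0 ?E1 ?E2 // subn_gt0.
have e0 := e_gt0 0; have e1 := e_gt0 1; have e2 := e_gt0 2.
(* Positivity of the other exponents forces m e_1 < a m n and n e_2 < a m n. *)
have l1 : ((e 1%R).-1 < (a * n).-1)%N by nia.
have l2 : ((e 2%R).-1 < (a * m).-1)%N by nia.
have xT : (Ordinal l1, Ordinal l2) \in triangle a m n by rewrite inE /= !prednK //; lia.
exists (enum_rank_in xT (Ordinal l1, Ordinal l2)); apply/mnmP => i.
have [+ + +] := muE (enum_rank_in xT (Ordinal l1, Ordinal l2)).
rewrite enum_rankK_in //= !prednK // => m0 m1 m2.
by case: (ord3P i) => ->; rewrite ?m0 ?m1 ?m2 //; lia.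
Qed.
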